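(* Let $A\in\mathbb{R}^{m\times n}$, $b\in\mathbb{R}^m$, $c\in\mathbb{R}^n$, and $X\subseteq\mathbb{Z}^n$. Suppose that $\overline{\operatorname{conv}}(X)$ is locally polyhedral. If the optimization problem of minimizing $c\cdot x$ subject to $Ax\geq b$ and $x\in\overline{\operatorname{conv}}(X)$ admits an optimal solution (i.e., the infimum is attained by some feasible point), then $v^L=\bar v^\star$.
   Context: Inequalities between vectors are componentwise, $\mathbb{R}_+^m$ is the set of vectors of $\mathbb{R}^m$ with nonnegative entries, and $\cdot$ is the standard inner product. $\operatorname{conv}(X)$ is the convex hull of $X$ and $\overline{\operatorname{conv}}(X)$ is the closure of $\operatorname{conv}(X)$. The dual function is $$\mathcal{G}(\lambda)=\inf\{c\cdot x+\lambda\cdot(b-Ax)\colon x\in X\}\in\mathbb{R}\cup\{\pm\infty\},\qquad \lambda\in\mathbb{R}_+^m,$$ and $v^L=\sup\{\mathcal{G}(\lambda)\colon\lambda\in\mathbb{R}_+^m\}$. Further, $\bar v^\star=\inf\{c\cdot x\colon Ax\geq b,\ x\in\overline{\operatorname{conv}}(X)\}$. Infima and suprema are taken in the extended reals (with $\inf\varnothing=+\infty$). A closed convex set $K\subseteq\mathbb{R}^n$ is locally polyhedral if its intersection with every box (product of compact intervals $\prod_{i=1}^n[l_i,u_i]$) is a polytope (the convex hull of finitely many points, possibly empty). *)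

(* Defs.v *)
From HB Require Import structures.
From mathcomp Require Import all_boot all_order all_algebra.
From mathcomp Require Import all_classical all_reals all_analysis.

Set Implicit Arguments.
Unset Strict Implicit.
Unset Printing Implicit Defensive.

Import Order.TTheory GRing.Theory Num.Theory.
Import numFieldNormedType.Exports.

Local Open Scope classical_set_scope.
Local Open Scope ring_scope.

Definition dotv (R : realType) (n : nat) (u v : 'cV[R]_n) : R :=
  \sum_(i < n) u i 0 * v i 0.

Definition lev (R : realType) (n : nat) (u v : 'cV[R]_n) : Prop :=
  forall i : 'I_n, u i 0 <= v i 0.

Definition integral_vec (R : realType) (n : nat) : set 'cV[R]_n :=
  [set x | forall i : 'I_n, x i 0 \is a Num.int].

Definition conv_hull (R : realType) (n : nat) (X : set 'cV[R]_n) :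
    set 'cV[R]_n :=
  [set x | exists (k : nat) (w : 'I_k -> R) (p : 'I_k -> 'cV[R]_n),
      [/\ forall i, 0 <= w i,
          \sum_(i < k) w i = 1,
          forall i, X (p i)
        & x = \sum_(i < k) w i *: p i]].

(* The topology on 'cV[R]_n is the entrywise one, i.e., the usual topology of
   R^n (the instance also covers n = 0). *)
Definition closed_conv_hull (R : realType) (n : nat) (X : set 'cV[R]_n) :
    set 'cV[R]_n :=
  closure (conv_hull X).

Definition is_polytope (R : realType) (n : nat) (P : set 'cV[R]_n) : Prop :=
  exists2 V : set 'cV[R]_n, finite_set V & P = conv_hull V.

Definition box (R : realType) (n : nat) (l u : 'cV[R]_n) : set 'cV[R]_n :=
  [set x | lev l x /\ lev x u].

(* Meant for closed convex K only.  When some l i 0 > u i 0 the box is empty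
   and so is the polytope, hence l and u are left unconstrained. *)
Definition locally_polyhedral (R : realType) (n : nat) (K : set 'cV[R]_n) :
    Prop :=
  forall l u : 'cV[R]_n, is_polytope (K `&` box l u).

Definition dual_function (R : realType) (m n : nat) (A : 'M[R]_(m, n))
    (b : 'cV[R]_m) (c : 'cV[R]_n) (X : set 'cV[R]_n) (lam : 'cV[R]_m) :
    \bar R :=
  ereal_inf [set (dotv c x + dotv lam (b - A *m x))%:E | x in X].

Definition dual_value (R : realType) (m n : nat) (A : 'M[R]_(m, n))
    (b : 'cV[R]_m) (c : 'cV[R]_n) (X : set 'cV[R]_n) : \bar R :=
  ereal_sup [set dual_function A b c X lam | lam in [set lam | lev 0 lam]].

Definition feasible_set (R : realType) (m n : nat) (A : 'M[R]_(m, n))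
    (b : 'cV[R]_m) (X : set 'cV[R]_n) : set 'cV[R]_n :=
  [set x | lev b (A *m x) /\ closed_conv_hull X x].

Definition closed_primal_value (R : realType) (m n : nat) (A : 'M[R]_(m, n))
    (b : 'cV[R]_m) (c : 'cV[R]_n) (X : set 'cV[R]_n) : \bar R :=
  ereal_inf [set (dotv c x)%:E | x in feasible_set A b X].

Definition admits_optimal_solution (R : realType) (m n : nat)
    (A : 'M[R]_(m, n)) (b : 'cV[R]_m) (c : 'cV[R]_n) (X : set 'cV[R]_n) :
    Prop :=
  exists2 x, feasible_set A b X x & (dotv c x)%:E = closed_primal_value A b c X.

(* Main.v *)
(** Let [K] be the closed convex hull of [X], [x] an optimal solution, and
    [conv V], with [V] finite, the intersection of [K] with the box of radius 1
    around [x]. Every segment from [x] to a point of [K] starts inside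
    [conv V], so [K] is contained in [x + T], where [T] is the finitely
    generated cone spanned by [V - x]. By convexity, [x] also minimizes [c] over
    [x + T] subject to the linear constraints. Farkas' lemma for this linear
    program gives a multiplier whose Lagrangian is minimized at [x] over
    [x + T], hence over [X], with complementary slackness, so the dual value
    reaches the primal one. *)
Require Import Defs.
From HB Require Import structures.
From mathcomp Require Import all_boot all_order all_algebra.
From mathcomp Require Import all_classical all_reals all_analysis.
From mathcomp Require Import ring lra.

Import Order.TTheory GRing.Theory Num.Theory.
Import numFieldNormedType.Exports.

Local Open Scope classical_set_scope.
Local Open Scope ring_scope.

(** * Bilinearity and positivity of the inner product *)

Section DotProduct.
Context {R : realType} {n : nat}.
Implicit Types (u v w : 'cV[R]_n) (a : R).

Lemma dotvC u v : dotv u v = dotv v u.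
Proof. by apply: eq_bigr => i _; rewrite mulrC. Qed.

Lemma dotvDr u v w : dotv u (v + w) = dotv u v + dotv u w.
Proof. by rewrite -big_split; apply: eq_bigr => i _; rewrite mxE mulrDr. Qed.

Lemma dotvZr a u v : dotv u (a *: v) = a * dotv u v.
Proof. by rewrite mulr_sumr; apply: eq_bigr => i _; rewrite mxE mulrCA. Qed.

Lemma dotvDl u v w : dotv (u + v) w = dotv u w + dotv v w.
Proof. by rewrite dotvC dotvDr !(dotvC w). Qed.

Lemma dotvZl a u v : dotv (a *: u) v = a * dotv u v.
Proof. by rewrite dotvC dotvZr dotvC. Qed.

Lemma dotvBr u v w : dotv u (v - w) = dotv u v - dotv u w.
Proof. by rewrite -scaleN1r dotvDr dotvZr mulN1r. Qed.

Lemma dotvBl u v w : dotv (u - v) w = dotv u w - dotv v w.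
Proof. by rewrite dotvC dotvBr !(dotvC w). Qed.

Lemma dotv0 u : dotv u 0 = 0.
Proof. by rewrite -(scale0r u) dotvZr mul0r. Qed.

Lemma dotv_sumr k u (F : 'I_k -> 'cV[R]_n) :
  dotv u (\sum_(i < k) F i) = \sum_(i < k) dotv u (F i).
Proof.
by apply: (big_morph (dotv u)) => [x y|]; [exact: dotvDr | exact: dotv0].
Qed.

Lemma dotv_ge0 u v : lev 0 u -> lev 0 v -> 0 <= dotv u v.
Proof.
move=> u0 v0; apply: sumr_ge0 => i _.
by have := u0 i; have := v0 i; rewrite !mxE => vi ui; exact: mulr_ge0.
Qed.

Lemma dotvv_eq0 u : dotv u u <= 0 -> u = 0.
Proof.
move=> uu; apply/matrixP => i j; rewrite ord1 mxE.
have sq_ge0 (k : 'I_n) : true -> 0 <= u k 0 * u k 0 by rewrite -expr2 sqr_ge0.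
have /eqP : dotv u u = 0 by apply/eqP; rewrite eq_le uu sumr_ge0.
by rewrite psumr_eq0// => /allP/(_ i (mem_index_enum i)); rewrite mulf_eq0 orbb => /eqP.
Qed.

End DotProduct.

(** * Transposes as adjoints, and Farkas' lemma *)

Lemma dotv_mulmx {R : realType} {m n : nat} (A : 'M[R]_(m, n)) u v :
  dotv u (A *m v) = dotv (A^T *m u) v.
Proof.
transitivity (\sum_(i < m) \sum_(j < n) u i 0 * A i j * v j 0).
  apply: eq_bigr => i _; rewrite mxE mulr_sumr.
  by apply: eq_bigr => j _; rewrite mulrA.
rewrite exchange_big; apply: eq_bigr => j _; rewrite mxE mulr_suml.
by apply: eq_bigr => i _; rewrite mxE (mulrC (u i 0)).
Qed.

(* Bartl's induction: if dropping [a ord0] breaks the implication at some [y],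
   project along [y] onto the kernel of [a ord0] and apply the induction
   hypothesis to the remaining functionals there. *)
Lemma farkas {R : realType} {n k : nat} (a : 'I_k -> 'cV[R]_n) (c : 'cV[R]_n) :
  (forall x, (forall i, 0 <= dotv (a i) x) -> 0 <= dotv c x) ->
  exists2 lam : 'I_k -> R, (forall i, 0 <= lam i) & c = \sum_(i < k) lam i *: a i.
Proof.
elim: k a c => [|k IH] a c ac.
  exists (fun=> 0) => //; rewrite big_ord0; apply: dotvv_eq0.
  have : 0 <= dotv c (-1 *: c) by apply: ac; case.
  by rewrite dotvZr mulN1r oppr_ge0.
pose cons_fun (l0 : R) (lam : 'I_k -> R) i :=
  if unlift ord0 i is Some j then lam j else l0.
have cons_fun_ge0 l0 lam : 0 <= l0 -> (forall i, 0 <= lam i) ->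
    forall i, 0 <= cons_fun l0 lam i.
  by move=> l00 lam0 i; rewrite /cons_fun; case: unlift.
have sum_cons_fun l0 lam : \sum_(i < k.+1) cons_fun l0 lam i *: a i =
    l0 *: a ord0 + \sum_(i < k) lam i *: a (lift ord0 i).
  rewrite big_ord_recl /cons_fun unlift_none; congr (_ + _).
  by apply: eq_bigr => i _; rewrite liftK.
have [tail_ac|] := pselect (forall x,
    (forall i, 0 <= dotv (a (lift ord0 i)) x) -> 0 <= dotv c x).
  have [lam lam0 ->] := IH _ _ tail_ac.
  exists (cons_fun 0 lam); first exact: cons_fun_ge0.
  by rewrite sum_cons_fun scale0r add0r.
move=> /existsNP[y0 /not_implyP[ay0 /negP]]; rewrite -ltNge => cy0.
have a0y0 : dotv (a ord0) y0 < 0.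
  rewrite ltNge; apply/negP => a0y0; move: cy0; rewrite ltNge ac// => i.
  by case: (unliftP ord0 i) => [j|] ->.
(* With the pairing against [a ord0] scaled to -1, adding [dotv (a ord0) x *: y] to [x] lands in the
   kernel of [a ord0]. *)
pose y := (- dotv (a ord0) y0)^-1 *: y0.
have inv_gt0 : 0 < (- dotv (a ord0) y0)^-1 by rewrite invr_gt0 oppr_gt0.
have a0y : dotv (a ord0) y = -1.
  by rewrite dotvZr invrN mulNr mulVf// lt_eqF.
have ay i : 0 <= dotv (a (lift ord0 i)) y by rewrite dotvZr mulr_ge0// ltW.
have cy : dotv c y <= 0 by rewrite dotvZr pmulr_rle0// ltW.
(* [proj] is the adjoint of the projection along [y]. *)
pose proj v := v + dotv v y *: a ord0.
have dot_proj v x : dotv (proj v) x = dotv v (x + dotv (a ord0) x *: y).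
  by rewrite dotvDl dotvZl dotvDr (dotvZr _ v y) [X in _ = _ + X]mulrC.
have [x pax|lam lam0 cE] := IH (fun i => proj (a (lift ord0 i))) (proj c).
  rewrite dot_proj; apply: ac => i.
  case: (unliftP ord0 i) => [j|] ->; first by rewrite -dot_proj.
  by rewrite dotvDr (dotvZr _ _ y) a0y mulrN1 subrr.
(* The first coefficient comes from expanding [proj] on both sides of [cE] and solving for [c]; its
   sign follows from [cy] and [ay]. *)
exists (cons_fun (- dotv c y + \sum_(i < k) lam i * dotv (a (lift ord0 i)) y) lam).
  apply: cons_fun_ge0 => //; rewrite addr_ge0 ?oppr_ge0// sumr_ge0// => i _.
  exact: mulr_ge0.
rewrite sum_cons_fun scalerDl scaleNr.
rewrite -[LHS](addrK (dotv c y *: a ord0)) -/(proj c) cE.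
under eq_bigr do rewrite scalerDr scalerA.
rewrite big_split/= -scaler_suml -addrA [RHS]addrC; congr (_ + _).
by rewrite addrC.
Qed.

(** The identity rows stacked below [G] encode [lev 0 x]; their multipliers are the slack in the
    resulting inequality. *)
Lemma farkas_mx {R : realType} {p q : nat} (G : 'M[R]_(p, q)) (c : 'cV[R]_q) :
  (forall x, lev 0 x -> lev 0 (G *m x) -> 0 <= dotv c x) ->
  exists2 lam, lev 0 lam & lev (G^T *m lam) c.
Proof.
move=> Gc; pose a (i : 'I_(p + q)) := (row i (col_mx G 1%:M))^T.
have aE i j : a i j 0 = col_mx G 1%:M i j by rewrite !mxE.
have dot_a i x : dotv (a i) x = (col_mx G 1%:M *m x) i 0.
  by rewrite mxE; apply: eq_bigr => j _; rewrite aE.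
have [x ax|lam lam0 cE] := farkas a c.
  apply: Gc => i; rewrite [leLHS]mxE.
    by have := ax (rshift p i); rewrite dot_a mul_col_mx col_mxEd mul1mx.
  by have := ax (lshift q i); rewrite dot_a mul_col_mx col_mxEu.
exists (\col_i lam (lshift q i)) => [i|j]; first by rewrite !mxE.
rewrite cE summxE big_split_ord/= mxE -[leLHS]addr0 lerD//.
  by apply: ler_sum => i _; rewrite [leRHS]mxE aE col_mxEu !mxE mulrC.
apply: sumr_ge0 => i _; rewrite mxE aE col_mxEd mxE.
by rewrite mulr_ge0// ler0n.
Qed.

(** * Convex hulls, their closures and feasible directions *)

Section ConvexHull.
Context {R : realType} {n : nat}.
Implicit Types (X : set 'cV[R]_n) (x y : 'cV[R]_n).

Lemma subset_conv_hull X : X `<=` conv_hull X.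
Proof.
move=> x Xx; exists 1%N, (fun=> 1), (fun=> x); split => //.
- by rewrite big_ord1.
- by rewrite big_ord1 scale1r.
Qed.

Lemma conv_hull_convex X (t : R) x y : 0 <= t <= 1 ->
  conv_hull X x -> conv_hull X y -> conv_hull X ((1 - t) *: x + t *: y).
Proof.
move=> /andP[t0 t1] [k [w [p [w0 w1 Xp ->]]]] [k' [w' [p' [w'0 w'1 Xp' ->]]]].
have sE (T : Type) (f : 'I_k -> T) (g : 'I_k' -> T) :
  (forall i, match fintype.split (lshift k' i) with inl i => f i | inr j => g j end = f i) /\
  (forall j, match fintype.split (rshift k j) with inl i => f i | inr j => g j end = g j).
  by split=> i; rewrite ?(unsplitK (inl i)) ?(unsplitK (inr i)).
exists (k + k')%N,
  (fun i => match fintype.split i with inl i => (1 - t) * w i | inr j => t * w' j end),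
  (fun i => match fintype.split i with inl i => p i | inr j => p' j end); split.
- by move=> i; case: fintype.split => j; rewrite mulr_ge0// subr_ge0.
- rewrite big_split_ord/=.
  under eq_bigr do rewrite (sE _ _ _).1.
  under [X in _ + X]eq_bigr do rewrite (sE _ _ _).2.
  by rewrite -!mulr_sumr w1 w'1 !mulr1 subrK.
- by move=> i; case: fintype.split.
- rewrite big_split_ord/= !scaler_sumr; congr (_ + _); apply: eq_bigr => i _.
    by rewrite !(sE _ _ _).1 scalerA.
  by rewrite !(sE _ _ _).2 scalerA.
Qed.

Lemma closureP X x : closure X x <->
  forall e : R, 0 < e -> exists2 y, X y & forall i, `|x i 0 - y i 0| < e.
Proof.
split=> [clx e e0|clx B /nbhs_ballP[e/= e0 eB]].
  have [y [Xy xy]] := clx _ (nbhsx_ballx x e e0).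
  by exists y => // i; exact: xy.2.
have [y Xy xy] := clx e e0; exists y; split => //; apply: eB; split=> // i j.
by rewrite ord1; exact: xy.
Qed.

(** Only [x] has to be approximated: replacing it by [z] moves the combination by
    [(1 - t) *: (x - z)]. *)
Lemma closed_conv_hull_star X (t : R) x y : 0 <= t <= 1 ->
  closed_conv_hull X x -> X y -> closed_conv_hull X (x + t *: (y - x)).
Proof.
move=> t01 /closureP clx Xy; apply/closureP => e e0; have [z Xz xz] := clx e e0.
exists ((1 - t) *: z + t *: y).
  by apply: conv_hull_convex => //; exact: subset_conv_hull.
move=> i; rewrite !mxE; apply: le_lt_trans (xz i).
have -> : x i 0 + t * (y i 0 - x i 0) - ((1 - t) * z i 0 + t * y i 0) =
  (1 - t) * (x i 0 - z i 0) by ring.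
rewrite normrM ler_piMl// ger0_norm; move: t01 => /andP[]; lra.
Qed.

Lemma conv_hull_dotv_ge X (h : 'cV[R]_n) (r : R) :
  (forall x, X x -> r <= dotv h x) -> forall x, conv_hull X x -> r <= dotv h x.
Proof.
move=> hX _ [k [w [p [w0 w1 Xp ->]]]]; rewrite dotv_sumr.
rewrite -[r]mul1r -w1 mulr_suml; apply: ler_sum => i _.
by rewrite dotvZr ler_wpM2l// hX.
Qed.

Lemma closed_conv_hull_dotv_ge X (h : 'cV[R]_n) (r : R) :
  (forall x, X x -> r <= dotv h x) ->
  forall x, closed_conv_hull X x -> r <= dotv h x.
Proof.
move=> hX x /closureP clx; apply/ler_addgt0Pr => e e0.
pose S := 1 + \sum_(i < n) `|h i 0|.
(* Moving each entry by less than [e / S] changes [dotv h] by at most [e]; the summand 1 keeps [S]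
   positive when [h] is zero. *)
have S0 : 0 < S by rewrite ltr_pwDl// sumr_ge0.
have [y Xy xy] := clx (e / S) (divr_gt0 e0 S0).
apply: (le_trans (conv_hull_dotv_ge _ _ _ hX _ Xy)).
rewrite -lerBlDl -dotvBr; apply: (le_trans (ler_norm _)).
apply: (le_trans (ler_norm_sum _ _ _)).
apply: (@le_trans _ _ (\sum_(i < n) `|h i 0| * (e / S))).
  apply: ler_sum => i _; rewrite normrM ler_wpM2l// !mxE distrC.
  exact: ltW (xy i).
rewrite -mulr_suml mulrCA ler_piMr ?(ltW e0)// ler_pdivrMr// mul1r.
by rewrite lerDr.
Qed.

(** Feasible directions form a convex cone: for a sum, take the midpoint of two steps of doubled
    length, hence the halved bound. *)
Lemma conv_hull_feasible_direction X x k (v : 'I_k -> 'cV[R]_n) (mu : 'I_k -> R) :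
  conv_hull X x -> (forall i, X (v i)) -> (forall i, 0 <= mu i) ->
  exists2 t, 0 < t & forall s, 0 <= s <= t ->
    conv_hull X (x + s *: \sum_(i < k) mu i *: (v i - x)).
Proof.
move=> Xx Xv mu0.
pose feasible d := exists2 t : R, 0 < t & forall s, 0 <= s <= t ->
    conv_hull X (x + s *: d).
suff : feasible (\sum_(i < k) mu i *: (v i - x)) by [].
apply: big_ind => [|d d' [t t0 td] [t' t'0 td']|i _].
- by exists 1 => // s _; rewrite scaler0 addr0.
- exists (Num.min t t' / 2); first by rewrite divr_gt0// lt_min t0.
  move=> s /andP[s0]; rewrite ler_pdivlMr// le_min => /andP[st st'].
  have -> : x + s *: (d + d') =
      (1 - 2^-1) *: (x + (s * 2) *: d) + 2^-1 *: (x + (s * 2) *: d').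
    by apply/matrixP => i j; rewrite !mxE; field.
  apply: conv_hull_convex; [lra|apply: td|apply: td'];
    by rewrite ?st ?st' mulr_ge0.
- have [->|mui0] := eqVneq (mu i) 0.
    by exists 1 => // s _; rewrite scale0r scaler0 addr0.
  have mui : 0 < mu i by rewrite lt_def mui0 mu0.
  exists (mu i)^-1; first by rewrite invr_gt0.
  move=> s /andP[s0 s1]; rewrite scalerA.
  have -> : x + (s * mu i) *: (v i - x) = (1 - s * mu i) *: x + (s * mu i) *: v i.
    by apply/matrixP => a b; rewrite !mxE; ring.
  apply: conv_hull_convex => //; last exact: subset_conv_hull.
  by rewrite mulr_ge0//= -(@mulVf _ (mu i))// ler_pM2r.
Qed.

End ConvexHull.

(** * Lagrangian bounds and the optimal multiplier *)

Section Duality.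
Context {R : realType} {m n : nat}.
Context (A : 'M[R]_(m, n)) (b : 'cV[R]_m) (c : 'cV[R]_n) (X : set 'cV[R]_n).

Lemma lagrangianE lam x :
  dotv c x + dotv lam (b - A *m x) = dotv lam b + dotv (c - A^T *m lam) x.
Proof. by rewrite dotvBr dotvBl dotv_mulmx; ring. Qed.

(** The Lagrangian is affine in [x], so a lower bound on [X] extends to the closed convex hull,
    where feasibility makes the penalty nonpositive. *)
Lemma weak_duality : (dual_value A b c X <= closed_primal_value A b c X)%E.
Proof.
apply: ge_ereal_sup => _ [lam lam0 <-]; apply: le_ereal_inf_tmp => _ [x [bx Kx] <-].
rewrite leNgt; apply/negP => lt_x.
(* A real [r] is interposed because the dual function could still be [+oo] here. *)
have [r xr r_le] : exists2 r, dotv c x < r & (r%:E <= dual_function A b c X lam)%E.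
  move: lt_x; case: (dual_function A b c X lam) => [r| |] // xr.
    by exists r.
  by exists (dotv c x + 1); rewrite ?ltrDl ?leey.
have : r - dotv lam b <= dotv (c - A^T *m lam) x.
  apply: closed_conv_hull_dotv_ge Kx => y Xy.
  rewrite lerBlDl -lagrangianE -lee_fin; apply: (le_trans r_le).
  by apply: ereal_inf_lbound; exists y.
rewrite lerBlDl -lagrangianE; apply/negP; rewrite -ltNge.
apply: le_lt_trans xr; rewrite gerDl -oppr_ge0 -mulN1r -dotvZr scaleN1r opprB.
by apply: dotv_ge0 => // i; rewrite !mxE subr_ge0; have := bx i; rewrite mxE.
Qed.

(* Farkas is applied in the space of conic combinations of the generators
   [V - x] of the feasible directions at [x], together with one extra column
   [A x - b] of cost [0]; that column enforces complementary slackness. *)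
Lemma optimal_multiplier (V : set 'cV[R]_n) x :
  finite_set V -> conv_hull V x -> lev b (A *m x) ->
  (forall y, conv_hull V y -> lev b (A *m y) -> dotv c x <= dotv c y) ->
  exists2 lam, lev 0 lam & dotv lam (A *m x - b) <= 0 /\
    forall v, V v -> 0 <= dotv (c - A^T *m lam) (v - x).
Proof.
move=> /finite_seqP[s VE] Vx bx opt.
pose v (j : 'I_(size s)) := s`_j.
have Vv j : V (v j) by rewrite VE /= mem_nth.
pose D := \matrix_(i < n, j < size s) (v j - x) i 0.
have DE (mu : 'cV_(size s)) : D *m mu = \sum_(j < size s) mu j 0 *: (v j - x).
  apply/matrixP => i j; rewrite ord1 summxE mxE; apply: eq_bigr => l _.
  by rewrite !mxE mulrC.
pose G := row_mx (A *m D) (A *m x - b).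
have [mu mu0 Gmu|lam lam0] := farkas_mx G (col_mx (D^T *m c) (0 : 'cV_1)).
  pose nu := usubmx mu; pose z := dsubmx mu 0 0.
  have z0 : 0 <= z by have := mu0 (rshift _ 0); rewrite /z !mxE.
  have nu0 j : 0 <= nu j 0 by have := mu0 (lshift _ j); rewrite /nu !mxE.
  have muE : mu = col_mx nu (dsubmx mu) by rewrite vsubmxK.
  have -> : dotv (col_mx (D^T *m c) 0) mu = dotv c (D *m nu).
    rewrite dotv_mulmx muE /dotv big_split_ord/= [X in _ + X]big1 ?addr0.
      by apply: eq_bigr => j _; rewrite !col_mxEu.
    by move=> j _; rewrite !col_mxEd mxE mul0r.
  have [t t0 tP] := conv_hull_feasible_direction _ _ _ _ _ Vx Vv nu0.
  (* [e <= t] keeps the point in the hull. [e * z <= 1] keeps it feasible, as its residual is at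
     least [(1 - e * z) *: (A *m x - b)]. *)
  pose e := Num.min t (1 + z)^-1.
  have e0 : 0 < e by rewrite lt_min t0 invr_gt0 ltr_pwDl.
  have ez : e * z <= 1.
    apply: (@le_trans _ _ ((1 + z)^-1 * z)).
      by rewrite ler_wpM2r// ge_min lexx orbT.
    by rewrite mulrC ler_pdivrMr ?mul1r ?lerDr// ltr_pwDl.
  have : dotv c x <= dotv c (x + e *: (D *m nu)).
    apply: opt => [|i].
      by rewrite DE; apply: tP; rewrite (ltW e0) ge_min lexx.
    have := Gmu i; rewrite /G [in X in X -> _]muE mul_row_col -mulmxA mulmxDr -scalemxAr.
    rewrite [X in _ <= X -> _]mxE [X in _ <= _ + X -> _]mxE big_ord1 -/z.
    have := bx i; set Ax := A *m x; set Ad := A *m (D *m nu).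
    rewrite !mxE => bxi H; nra.
  by rewrite dotvDr dotvZr lerDl pmulr_rge0.
rewrite /G tr_row_mx mul_col_mx => Glam; exists lam => //; split.
  by have := Glam (rshift _ 0); rewrite !col_mxEd !mxE dotvC; under eq_bigr do rewrite mxE.
move=> u; rewrite VE /= => /(nthP 0)[j js <-].
have := Glam (lshift 1 (Ordinal js)); rewrite !col_mxEu trmx_mul -mulmxA.
have DtE w : (D^T *m w) (Ordinal js) 0 = dotv w (s`_j - x).
  by rewrite mxE; apply: eq_bigr => i _; rewrite !mxE mulrC.
by rewrite !DtE dotvBl subr_ge0.
Qed.

End Duality.

Theorem theorem1p2 (R : realType) (m n : nat) (A : 'M[R]_(m, n))
    (b : 'cV[R]_m) (c : 'cV[R]_n) (X : set 'cV[R]_n)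
    (X_integral : X `<=` @integral_vec R n)
    (X_locally_polyhedral : locally_polyhedral (closed_conv_hull X))
    (optimal_exists : admits_optimal_solution A b c X) :
  dual_value A b c X = closed_primal_value A b c X.
Proof.
apply/eqP; rewrite eq_le weak_duality /=.
have [x [bx Kx] xopt] := optimal_exists; rewrite -xopt.
have [V finV VE] := X_locally_polyhedral (x - const_mx 1) (x + const_mx 1).
have Vx : conv_hull V x.
  by rewrite -VE; split=> //; split=> i; rewrite !mxE; lra.
have [y Vy bAy|lam lam0 [slack lamV]] := optimal_multiplier A b c V x finV Vx bx.
  rewrite -lee_fin xopt; apply: ereal_inf_lbound; exists y => //; split=> //.
  by move: Vy; rewrite -VE => -[].
apply: (@le_trans _ _ (dual_function A b c X lam)); last first.
  by apply: ereal_sup_ubound; exists lam.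
apply: le_ereal_inf_tmp => _ [y Xy <-]; rewrite lee_fin.
(* This bounds the Lagrangian at [y] below by its value at [x], which [slack] bounds below by
   [dotv c x]. *)
suff : 0 <= dotv (c - A^T *m lam) (y - x).
  rewrite lagrangianE dotvBr !dotvBl -!dotv_mulmx.
  by move: slack; rewrite dotvBr; lra.
(* Dividing [y - x] by [S] makes every entry at most 1 in absolute value, so the point lies in the
   box; [1 <= S] keeps it on the segment from [x] to [y]. *)
pose S := 1 + \sum_(i < n) `|(y - x) i 0|.
have S1 : 1 <= S by rewrite lerDl sumr_ge0.
have S0 : 0 < S by apply: lt_le_trans S1.
have : conv_hull V (x + S^-1 *: (y - x)).
  rewrite -VE; split.
    by apply: closed_conv_hull_star => //; rewrite invr_ge0 (ltW S0) invf_le1.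
  suff small i : `|S^-1 * (y - x) i 0| <= 1.
    by split=> i; have := small i; rewrite ler_norml !mxE; lra.
  rewrite normrM gtr0_norm ?invr_gt0// mulrC ler_pdivrMr// mul1r.
  by rewrite /S (bigD1 i)//= addrCA lerDl addr_ge0// sumr_ge0.
have lamV' v : V v -> dotv (c - A^T *m lam) x <= dotv (c - A^T *m lam) v.
  by move=> /lamV; rewrite dotvBr subr_ge0.
move=> /(conv_hull_dotv_ge _ _ _ lamV').
by rewrite dotvDr dotvZr lerDl pmulr_rge0// invr_gt0.
Qed.
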